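(* Let $(M,F)$ be a Finsler manifold and let $R$ be the h-curvature of its Cartan connection. If $$\mathfrak{S}_{\overline{X},\overline{Y},\overline{Z}}\,R(\overline{X},\overline{Y})\overline{Z}=0$$ for all $\pi$-vector fields $\overline{X},\overline{Y},\overline{Z}$, where $\mathfrak{S}_{\overline{X},\overline{Y},\overline{Z}}$ denotes the cyclic sum over $\overline{X},\overline{Y},\overline{Z}$, then the two distributions $\mathcal{N}_R$ and $\mathrm{Ker}_R$ coincide; that is, for every $z\in\mathcal{D}$ (where $\mathcal{D}$ is the domain of $F$), with $x=\pi(z)$, $\mathcal{N}_R(x)=\mathrm{Ker}_R(x)$ as subspaces of $T_xM$, both computed at $z$.
   Context: **Finsler manifold.** $M$ is a smooth manifold and $\pi$ denotes the projection of the bundle of nonzero tangent vectors of $M$ onto $M$. A Finsler function $F$ is a smooth positive function on a nonempty open set $\mathcal{D}$ of nonzero tangent vectors that is conic (invariant under $y\mapsto ty$, $t>0$). $F$ is positively homogeneous of degree 1 in $y$, and the Finsler metric $g_{ij}=\frac12\frac{\partial^2F^2}{\partial y^i\partial y^j}$ is nondegenerate on $\mathcal{D}$. The classical case is that $\mathcal{D}$ consists of all nonzero tangent vectors and $g$ is positive definite. All objects below live over $\mathcal{D}$. **Pullback bundle.** $\pi^{-1}(TM)\to\mathcal{D}$ is the pullback of $TM$ along $\pi$, with fiber $\{z\}\times T_{\pi z}M\simeq T_{\pi z}M$ at $z$. Sections of it are called $\pi$-vector fields and are denoted by barred letters. The Finsler metric $g$ is a metric on this bundle. For a vector (field) $X$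 on $\mathcal{D}$, put $\overline{X}=\pi_*X$, where $\pi_*$ is the tangent map of $\pi$, regarded as taking values in $\pi^{-1}(TM)$. The fundamental $\pi$-vector field is $\overline{\eta}(z)=(z,z)$. **Regular connections.** Let $D$ be a linear connection on $\pi^{-1}(TM)$ and let $K(X)=D_X\overline{\eta}$. Put $V_z=\ker(\pi_* )_z$ (vertical space) and $H_z=\{X\in T_z\mathcal{D}: K(X)=0\}$ (horizontal space). $D$ is regular if $T_z\mathcal{D}=V_z\oplus H_z$ for all $z\in\mathcal{D}$. Then $\pi_*:H_z\to T_{\pi z}M$ and $K:V_z\to T_{\pi z}M$ are isomorphisms. **Torsion and curvature.** The classical torsion and curvature are $\mathbf{T}(X,Y)=D_X\overline{Y}-D_Y\overline{X}-\pi_*[X,Y]$ and $\mathbf{K}(X,Y)\overline{Z}=D_XD_Y\overline{Z}-D_YD_X\overline{Z}-D_{[X,Y]}\overline{Z}$. The (h)hv-torsion is $T(\overline{X},\overline{Y})=\mathbf{T}(X',Y')$, where $X'$ is the vertical vector with $K(X')=\overline{X}$ and $Y'$ is the horizontal vector with $\pi_*Y'=\overline{Y}$. The h-curvature is $R(\overline{X},\overline{Y})\overline{Z}=\mathbf{K}(X'',Y'')\overline{Z}$, where $X'',Y''$ are the horizontal vectors with $\pi_*X''=\overline{X}$, $\pi_*Y''=\overline{Y}$. **Cartan connection.** The Cartan connection $\nabla$ of $(M,F)$ is the unique regular connection on $\pi^{-1}(TM)$ that is metrical ($\nabla g=0$), satisfies $\mathbf{T}(X,Y)=0$ for all horizontal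 $X,Y$, and satisfies $g(T(\overline{X},\overline{Y}),\overline{Z})=g(T(\overline{X},\overline{Z}),\overline{Y})$. $R$ denotes its h-curvature. **Nullity and kernel.** For $z\in\mathcal{D}$ and $x=\pi z$: - $\mathcal{N}_R(z)=\{X\in H_z: R(\overline{X},\overline{Y})=0\ \text{ for all } Y\in H_z\}$, and the nullity space is $\mathcal{N}_R(x)=\pi_*(\mathcal{N}_R(z))\subset T_xM$. - The kernel space is $\mathrm{Ker}_R(x)=\{\overline{X}\in\{z\}\times T_xM\simeq T_xM: R(\overline{Y},\overline{Z})\overline{X}=0\ \text{ for all } Y,Z\in H_z\}$. Both spaces depend on the chosen $z$ over $x$. *)

(* Defs.v *)
From HB Require Import structures.
From mathcomp Require Import all_boot all_order all_algebra.
From mathcomp Require Import all_classical all_reals all_analysis.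

Set Implicit Arguments.
Unset Strict Implicit.
Unset Printing Implicit Defensive.

Import Order.TTheory GRing.Theory Num.Theory.
Import numFieldNormedType.Exports.
Local Open Scope classical_set_scope.
Local Open Scope ring_scope.

(* f is C^oo on a neighbourhood of a: every iterated directional derivative
   of f is (Frechet) differentiable near a. *)
Definition smooth_at (R : realType) (m : nat) (W : normedModType R)
    (f : 'rV[R]_m -> W) (a : 'rV[R]_m) : Prop :=
  \forall b \near a, forall vs : seq 'rV[R]_m,
    differentiable (foldr (fun v h => 'D_v h) f vs) b.

(* A set with an n-dimensional atlas; the axioms are in [smooth_manifold].
   phi c is only meaningful on dom c, and psi c, its inverse, only on
   phi c @` dom c.

   chart_at p is a chart around p chosen once and for all.  It is used to
   represent the tangent space T_pM: a tangent vector at p is the row vector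
   of its components in chart_at p, so T_pM is the vector space 'rV[R]_n for
   every p (but vectors at different points must not be compared directly). *)
Record atlas (R : realType) (n : nat) := Atlas {
  point :> Type;
  chart : Type;
  dom : chart -> set point;
  phi : chart -> point -> 'rV[R]_n;
  psi : chart -> 'rV[R]_n -> point;
  chart_at : point -> chart }.

(* The topology induced by the atlas. *)
Definition atlas_open (R : realType) (n : nat) (M : atlas R n) (U : set M) :
    Prop :=
  forall c : chart M, open (phi c @` (U `&` dom c)).

Record smooth_manifold (R : realType) (n : nat) (M : atlas R n) : Prop := {
  chart_atP : forall p : M, dom (chart_at p) p;
  phiK : forall (c : chart M) (p : M), dom c p -> psi c (phi c p) = p;
  open_overlap : forall c c' : chart M, open (phi c @` (dom c `&` dom c'));
  smooth_transition : forall (c c' : chart M) (p : M), dom c p -> dom c' p ->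
    smooth_at (phi c' \o psi c) (phi c p);
  manifold_hausdorff : forall p q : M, p <> q -> exists U V : set M,
    [/\ atlas_open U, atlas_open V, U p, V q & U `&` V = set0];
  manifold_second_countable : exists B : set (set M),
    [/\ countable B, forall U, B U -> atlas_open U &
        forall (U : set M) (p : M), atlas_open U -> U p ->
          exists V, [/\ B V, V p & V `<=` U]] }.

(* Components in the chart c of the tangent vector v at p. *)
Definition vec_coord (R : realType) (n : nat) (M : atlas R n) (c : chart M)
    (p : M) (v : 'rV[R]_n) : 'rV[R]_n :=
  'D_v (phi c \o psi (chart_at p)) (phi (chart_at p) p).

(* The tangent vector at p with components b in the chart c. *)
Definition vec_of_coord (R : realType) (n : nat) (M : atlas R n)
    (c : chart M) (p : M) (b : 'rV[R]_n) : 'rV[R]_n :=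
  'D_b (phi (chart_at p) \o psi c) (phi c p).

(* The tangent bundle with its induced charts (x, y) |-> (x^i, y^i).  A point
   is a pair of a point x and a tangent vector at x.  The construction applies
   to any atlas, so T_z(TM) makes sense as well. *)
Definition tangent_bundle (R : realType) (n : nat) (M : atlas R n) :
    atlas R (n + n) :=
  @Atlas R (n + n) (M * 'rV[R]_n)%type (chart M)
    (fun c => [set z | dom c z.1])
    (fun c z => row_mx (phi c z.1) (vec_coord c z.1 z.2))
    (fun c a => (psi c (lsubmx a),
                 vec_of_coord c (psi c (lsubmx a)) (rsubmx a)))
    (fun z => chart_at z.1).

Definition proj (R : realType) (n : nat) (M : atlas R n)
    (z : tangent_bundle M) : M := z.1.

Definition smooth_fun_at (R : realType) (n : nat) (M : atlas R n)
    (W : normedModType R) (f : M -> W) (p : M) : Prop :=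
  smooth_at (f \o psi (chart_at p)) (phi (chart_at p) p).

(* The derivative v(f) of f along the tangent vector v at p. *)
Definition vec_deriv (R : realType) (n : nat) (M : atlas R n)
    (W : normedModType R) (p : M) (v : 'rV[R]_n) (f : M -> W) : W :=
  'D_v (f \o psi (chart_at p)) (phi (chart_at p) p).

Definition tangent_map (R : realType) (m n : nat) (N : atlas R m)
    (M : atlas R n) (f : N -> M) (p : N) (v : 'rV[R]_m) : 'rV[R]_n :=
  vec_deriv p v (phi (chart_at (f p)) \o f).

(* X is a vector field (X q in T_qM) which is smooth near p; local fields are
   represented by total functions, arbitrary away from p. *)
Definition smooth_vfield_at (R : realType) (n : nat) (M : atlas R n)
    (X : M -> 'rV[R]_n) (p : M) : Prop :=
  smooth_fun_at (fun q => vec_coord (chart_at p) q (X q)) p.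

(* [X, Y]^i = X(Y^i) - Y(X^i), in the chart chart_at p. *)
Definition bracket (R : realType) (n : nat) (M : atlas R n)
    (X Y : M -> 'rV[R]_n) (p : M) : 'rV[R]_n :=
  vec_deriv p (X p) (fun q => vec_coord (chart_at p) q (Y q)) -
  vec_deriv p (Y p) (fun q => vec_coord (chart_at p) q (X q)).

(* The local vector field extending v which has constant components in
   chart_at p. *)
Definition extend_vec (R : realType) (n : nat) (M : atlas R n) (p : M)
    (v : 'rV[R]_n) : M -> 'rV[R]_n :=
  fun q => vec_of_coord (chart_at p) q v.

(* Coefficients g_ij of the Finsler metric in the linear coordinates of the
   fibre T_xM, x = proj z. *)
Definition finsler_matrix (R : realType) (n : nat) (M : atlas R n)
    (F : tangent_bundle M -> R) (z : tangent_bundle M) : 'M[R]_n :=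
  \matrix_(i, j) (2^-1 * 'D_(delta_mx 0 i : 'rV[R]_n)
    ('D_(delta_mx 0 j : 'rV[R]_n)
       (fun y : 'rV[R]_n => F (proj z, y) ^+ 2)) z.2).

Definition finsler_metric (R : realType) (n : nat) (M : atlas R n)
    (F : tangent_bundle M -> R) (z : tangent_bundle M) (u v : 'rV[R]_n) : R :=
  (u *m finsler_matrix F z *m v^T) 0 0.

(* Only the restriction of F to D matters. *)
Record finsler_function (R : realType) (n : nat) (M : atlas R n)
    (D : set (tangent_bundle M)) (F : tangent_bundle M -> R) : Prop := {
  finsler_nonempty : D !=set0;
  finsler_open : atlas_open D;
  finsler_nonzero : forall z, D z -> z.2 != 0;
  finsler_conic : forall z (t : R), D z -> 0 < t -> D (proj z, t *: z.2);
  finsler_smooth : forall z, D z -> smooth_fun_at F z;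
  finsler_pos : forall z, D z -> 0 < F z;
  finsler_homogeneous : forall z (t : R), D z -> 0 < t ->
    F (proj z, t *: z.2) = t * F z;
  finsler_nondegenerate : forall z, D z -> finsler_matrix F z \in unitmx }.

(* Y is a pi-vector field (Y w in T_{proj w}M) which is smooth near z. *)
Definition smooth_pivfield_at (R : realType) (n : nat) (M : atlas R n)
    (Y : tangent_bundle M -> 'rV[R]_n) (z : tangent_bundle M) : Prop :=
  smooth_fun_at (fun w => vec_coord (chart_at (proj z)) (proj w) (Y w)) z.

(* The local pi-vector field extending u which has constant components in
   the chart chart_at (proj z) of M. *)
Definition extend_pivec (R : realType) (n : nat) (M : atlas R n)
    (z : tangent_bundle M) (u : 'rV[R]_n) : tangent_bundle M -> 'rV[R]_n :=
  fun w => vec_of_coord (chart_at (proj z)) (proj w) u.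

Definition fundamental_pivfield (R : realType) (n : nat) (M : atlas R n) :
    tangent_bundle M -> 'rV[R]_n :=
  fun z => z.2.

(* N z X Y is the covariant derivative at z of the pi-vector field Y along the
   tangent vector X in T_z(TM). *)
Definition connection (R : realType) (n : nat) (M : atlas R n) : Type :=
  tangent_bundle M -> 'rV[R]_(n + n) ->
  (tangent_bundle M -> 'rV[R]_n) -> 'rV[R]_n.

Definition cov (R : realType) (n : nat) (M : atlas R n) (N : connection M)
    (X : tangent_bundle M -> 'rV[R]_(n + n))
    (Y : tangent_bundle M -> 'rV[R]_n) : tangent_bundle M -> 'rV[R]_n :=
  fun w => N w (X w) Y.

(* The operator acts on pi-vector fields defined near z.  It depends only on
   their germ at z: apply the Leibniz rule to the indicator function of a
   neighbourhood of z. *)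
Record linear_connection (R : realType) (n : nat) (M : atlas R n)
    (D : set (tangent_bundle M)) (N : connection M) : Prop := {
  connection_linear : forall z (a : R) (X X' : 'rV[R]_(n + n)) Y, D z ->
    smooth_pivfield_at Y z ->
    N z (a *: X + X') Y = a *: N z X Y + N z X' Y;
  connection_additive : forall z (X : 'rV[R]_(n + n)) Y Y', D z ->
    smooth_pivfield_at Y z -> smooth_pivfield_at Y' z ->
    N z X (fun w => Y w + Y' w) = N z X Y + N z X Y';
  connection_leibniz : forall z (X : 'rV[R]_(n + n))
      (f : tangent_bundle M -> R) Y, D z ->
    smooth_fun_at f z -> smooth_pivfield_at Y z ->
    N z X (fun w => f w *: Y w) = vec_deriv z X f *: Y z + f z *: N z X Y;
  connection_smooth : forall z (X : tangent_bundle M -> 'rV[R]_(n + n)) Y,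
    D z -> smooth_vfield_at X z -> smooth_pivfield_at Y z ->
    smooth_pivfield_at (cov N X Y) z }.

Definition bar (R : realType) (n : nat) (M : atlas R n)
    (z : tangent_bundle M) (X : 'rV[R]_(n + n)) : 'rV[R]_n :=
  tangent_map (@proj R n M) z X.

Definition connection_map (R : realType) (n : nat) (M : atlas R n)
    (N : connection M) (z : tangent_bundle M) (X : 'rV[R]_(n + n)) :
    'rV[R]_n :=
  N z X (@fundamental_pivfield R n M).

Definition vertical (R : realType) (n : nat) (M : atlas R n)
    (z : tangent_bundle M) : set 'rV[R]_(n + n) :=
  [set X | bar z X = 0].

Definition horizontal (R : realType) (n : nat) (M : atlas R n)
    (N : connection M) (z : tangent_bundle M) : set 'rV[R]_(n + n) :=
  [set X | connection_map N z X = 0].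

Definition regular_connection (R : realType) (n : nat) (M : atlas R n)
    (D : set (tangent_bundle M)) (N : connection M) : Prop :=
  linear_connection D N /\
  forall z, D z ->
    vertical z `&` horizontal N z = [set 0] /\
    forall X : 'rV[R]_(n + n), exists A B : 'rV[R]_(n + n),
      [/\ vertical z A, horizontal N z B & X = A + B].

(* The vertical X with K(X) = u and the horizontal X with pi_* X = u; both
   exist and are unique when the connection is regular. *)
Definition vertical_lift (R : realType) (n : nat) (M : atlas R n)
    (N : connection M) (z : tangent_bundle M) (u : 'rV[R]_n) :
    'rV[R]_(n + n) :=
  xget 0 [set X | vertical z X /\ connection_map N z X = u].

Definition horizontal_lift (R : realType) (n : nat) (M : atlas R n)
    (N : connection M) (z : tangent_bundle M) (u : 'rV[R]_n) :
    'rV[R]_(n + n) :=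
  xget 0 [set X | horizontal N z X /\ bar z X = u].

Definition torsion_field (R : realType) (n : nat) (M : atlas R n)
    (N : connection M) (X Y : tangent_bundle M -> 'rV[R]_(n + n))
    (z : tangent_bundle M) : 'rV[R]_n :=
  N z (X z) (fun w => bar w (Y w)) - N z (Y z) (fun w => bar w (X w)) -
  bar z (bracket X Y z).

Definition curvature_field (R : realType) (n : nat) (M : atlas R n)
    (N : connection M) (X Y : tangent_bundle M -> 'rV[R]_(n + n))
    (Z : tangent_bundle M -> 'rV[R]_n) (z : tangent_bundle M) : 'rV[R]_n :=
  N z (X z) (cov N Y Z) - N z (Y z) (cov N X Z) - N z (bracket X Y z) Z.

(* Torsion and curvature are tensors: their values on vectors at z are those
   on arbitrary smooth fields extending these vectors near z.  The extensions
   used here are the ones with constant components. *)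
Definition torsion (R : realType) (n : nat) (M : atlas R n)
    (N : connection M) (z : tangent_bundle M) (X Y : 'rV[R]_(n + n)) :
    'rV[R]_n :=
  torsion_field N (extend_vec z X) (extend_vec z Y) z.

Definition curvature (R : realType) (n : nat) (M : atlas R n)
    (N : connection M) (z : tangent_bundle M) (X Y : 'rV[R]_(n + n))
    (w : 'rV[R]_n) : 'rV[R]_n :=
  curvature_field N (extend_vec z X) (extend_vec z Y) (extend_pivec z w) z.

Definition hv_torsion (R : realType) (n : nat) (M : atlas R n)
    (N : connection M) (z : tangent_bundle M) (u v : 'rV[R]_n) : 'rV[R]_n :=
  torsion N z (vertical_lift N z u) (horizontal_lift N z v).

Definition h_curvature (R : realType) (n : nat) (M : atlas R n)
    (N : connection M) (z : tangent_bundle M) (u v w : 'rV[R]_n) :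
    'rV[R]_n :=
  curvature N z (horizontal_lift N z u) (horizontal_lift N z v) w.

Record cartan_connection (R : realType) (n : nat) (M : atlas R n)
    (D : set (tangent_bundle M)) (F : tangent_bundle M -> R)
    (N : connection M) : Prop := {
  cartan_regular : regular_connection D N;
  cartan_metrical : forall z (X : 'rV[R]_(n + n)) Y Z, D z ->
    smooth_pivfield_at Y z -> smooth_pivfield_at Z z ->
    vec_deriv z X (fun w => finsler_metric F w (Y w) (Z w)) =
    finsler_metric F z (N z X Y) (Z z) + finsler_metric F z (Y z) (N z X Z);
  cartan_h_torsion_free : forall z (X Y : 'rV[R]_(n + n)), D z ->
    horizontal N z X -> horizontal N z Y -> torsion N z X Y = 0;
  cartan_hv_torsion : forall z (u v w : 'rV[R]_n), D z ->
    finsler_metric F z (hv_torsion N z u v) w =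
    finsler_metric F z (hv_torsion N z u w) v }.

Definition nullity_horizontal (R : realType) (n : nat) (M : atlas R n)
    (N : connection M) (z : tangent_bundle M) : set 'rV[R]_(n + n) :=
  [set X | horizontal N z X /\
    forall Y, horizontal N z Y ->
      forall w, h_curvature N z (bar z X) (bar z Y) w = 0].

Definition nullity_space (R : realType) (n : nat) (M : atlas R n)
    (N : connection M) (z : tangent_bundle M) : set 'rV[R]_n :=
  bar z @` nullity_horizontal N z.

Definition kernel_space (R : realType) (n : nat) (M : atlas R n)
    (N : connection M) (z : tangent_bundle M) : set 'rV[R]_n :=
  [set u | forall Y Z, horizontal N z Y -> horizontal N z Z ->
    h_curvature N z (bar z Y) (bar z Z) u = 0].

(* Main.v *)
(* Write Rm(X,Y,Z,W) = g(R(X,Y)Z,W).  It is skew in X, Y by definition, and skew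
   in Z, W because g is parallel: for fields X, Y with constant components
   [X,Y] = 0, so expanding X(Y g(Z,W)) = Y(X g(Z,W)) with the metricity of the
   connection leaves g(R(X,Y)Z,W) + g(Z,R(X,Y)W) = 0.  Together with the cyclic
   identity this gives Rm(X,Y,Z,W) = Rm(Z,W,X,Y).  Since g is nondegenerate,
   R(X,.). = 0 then means the same as R(.,.)X = 0. *)
Require Import Defs.
From HB Require Import structures.
From mathcomp Require Import all_boot all_order all_algebra.
From mathcomp Require Import all_classical all_reals all_analysis.
From mathcomp Require Import ring lra.
Set Implicit Arguments.
Unset Strict Implicit.
Unset Printing Implicit Defensive.
Import Order.TTheory GRing.Theory Num.Theory.
Import numFieldNormedType.Exports.
Local Open Scope classical_set_scope.
Local Open Scope ring_scope.

(** * Directional derivatives and their symmetry *)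

(** The analytic core is the interchange of X and Y in X(Y g(Z,W)). As [smooth_at] speaks of
    iterated directional derivatives, the symmetry of second derivatives and the stability of
    smoothness under products and composition are derived from that form. The symmetry is used on
    the tangent bundle, whereas g is given as a Hessian along single fibres, in the chart chosen at
    each base point; that choice may jump from point to point, so the smoothness of g(Z,W) shows
    only after passing to one fixed chart. Metricity enters twice: at every point near z, which is
    why the extended fields must be smooth at neighbouring points too, and then at z on first
    covariant derivatives, whose components are no longer constant. Finally, R takes vectors of T_xM
    while nullity and kernel quantify over horizontal vectors; regularity provides a horizontal
    vector over each vector of T_xM. *)

Lemma near_eq_differentiable (R : realType) (V W : normedModType R)
    (f g : V -> W) (a : V) :
  (\forall x \near a, f x = g x) -> differentiable f a -> differentiable g a.
Proof.
move=> fg df.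
have E : g \o shift a = cst (g a) + 'd f a +o_ 0 id.
  apply/eqaddoP => e e0.
  have /eqaddoP/(_ e e0) H := diff_locally df.
  have fg0 : \forall x \near 0, f (x + a) = g (x + a).
    have : (x + a) @[x --> 0] --> a.
      rewrite -[X in _ --> X]add0r; apply: cvgD; [exact: cvg_id|exact: cvg_cst].
    by move=> /(_ _ fg).
  near=> x.
  have -> : (g \o shift a - (cst (g a) + 'd f a)) x =
            (f \o shift a - (cst (f a) + 'd f a)) x.
    rewrite /= !fctE /= /cst.
    have -> : g (x + a) = f (x + a) by apply/esym; near: x.
    by rewrite (nbhs_singleton fg).
  by near: x.
have dE : 'd g a = 'd f a :> (_ -> _) by apply: diff_unique => //; exact: diff_continuous.
by apply/diff_locallyP; rewrite dE; split=> //; exact: diff_continuous.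
Unshelve. all: by end_near. Qed.

Lemma derive_comp (R : realType) (U V W : normedModType R)
    (f : V -> W) (g : U -> V) (a v : U) :
  differentiable g a -> differentiable f (g a) ->
  'D_v (f \o g) a = 'D_('D_v g a) f (g a).
Proof.
move=> dg df; rewrite !deriveE//; last exact: differentiable_comp.
by rewrite diff_comp.
Qed.

Lemma derive_dirD (R : realType) (V W : normedModType R) (f : V -> W)
    (a : V) (k : R) (u v : V) :
  differentiable f a -> 'D_(k *: u + v) f a = k *: 'D_u f a + 'D_v f a.
Proof. by move=> df; rewrite !deriveE// linearP. Qed.

Lemma near_norm_lt (R : realType) (V : normedModType R) (a : V)
    (P : V -> Prop) :
  (\forall x \near a, P x) ->
  exists2 d : R, 0 < d & forall x, `|x - a| < d -> P x.
Proof.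
move=> /nbhs_normP[d /= d0 dP]; exists d => // x xa; apply: dP.
by rewrite /= distrC.
Qed.

Lemma derive_line (R : realType) (V W : normedModType R) (f : V -> W)
    (a v : V) (t : R) :
  'D_1 (fun s : R => f (a + s *: v)) t = 'D_v f (a + t *: v).
Proof.
rewrite /derive; set p := fun h => _; set q := fun h => _; suff -> : p = q by [].
by apply/funext => h; rewrite /p /q /= [h *: 1]mulr1 scalerDl addrCA.
Qed.

Lemma derivable_line (R : realType) (V W : normedModType R) (f : V -> W)
    (a v : V) (t : R) :
  derivable f (a + t *: v) v -> derivable (fun s : R => f (a + s *: v)) t 1.
Proof.
rewrite /derivable; set p := fun h => _; set q := fun h => _; suff -> : p = q by [].
by apply/funext => h; rewrite /p /q /= [h *: 1]mulr1 scalerDl addrCA.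
Qed.

Lemma derive_translate (R : realType) (V W : normedModType R) (f : V -> W)
    (a v c : V) :
  'D_v (fun x => f (x + c)) a = 'D_v f (a + c).
Proof.
rewrite /derive; set p := fun h => _; set q := fun h => _; suff -> : p = q by [].
by apply/funext => h; rewrite /p /q /= addrA.
Qed.

Lemma derivable_translate (R : realType) (V W : normedModType R) (f : V -> W)
    (a v c : V) :
  derivable f (a + c) v -> derivable (fun x => f (x + c)) a v.
Proof.
rewrite /derivable; set p := fun h => _; set q := fun h => _; suff -> : p = q by [].
by apply/funext => h; rewrite /p /q /= addrA.
Qed.

Lemma MVT_line (R : realType) (V : normedModType R) (f : V -> R) (a v : V)
    (h : R) : 0 < h ->
  (forall t, 0 <= t <= h -> derivable f (a + t *: v) v) ->
  exists2 t, 0 < t < h & f (a + h *: v) - f a = h * 'D_v f (a + t *: v).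
Proof.
move=> h0 df; pose p s := f (a + s *: v); pose dp s := 'D_v f (a + s *: v).
have pE : p h - p 0 = f (a + h *: v) - f a by rewrite /p scale0r addr0.
have dpE t : 'D_v f (a + t *: v) = dp t by [].
have ptP t : 0 <= t <= h -> is_derive t 1 p (dp t).
  by move=> th; split; [apply: derivable_line; exact: df|exact: derive_line].
rewrite -pE; clearbody p dp.
have ptI t : t \in `]0, h[%R -> is_derive t 1 p (dp t).
  by rewrite in_itv/= => /andP[t0 th]; apply: ptP; rewrite !ltW.
have pc : {within `[0, h], continuous p}.
  apply: derivable_within_continuous => t; rewrite in_itv/= => th.
  by have [] := ptP t th.
have [t th E] := MVT h0 ptI pc.
by exists t; [move: th; rewrite in_itv|rewrite E dpE subr0 mulrC].
Qed.

(** Two mean value steps: along [u] for the increment of [f] by [h *: v], then along [v] for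
    ['D_u f]. *)
Lemma second_difference (R : realType) (V : normedModType R) (f : V -> R)
    (a u v : V) (h : R) : 0 < h ->
  (forall s t, 0 <= s <= h -> 0 <= t <= h ->
    differentiable f (a + s *: u + t *: v) /\
    differentiable ('D_u f) (a + s *: u + t *: v)) ->
  exists s t : R, [/\ 0 < s < h, 0 < t < h &
    f (a + h *: u + h *: v) - f (a + h *: u) - f (a + h *: v) + f a =
    h * h * 'D_v ('D_u f) (a + s *: u + t *: v)].
Proof.
move=> h0 df.
have h0l : 0 <= (0 : R) <= h by rewrite lexx ltW.
have hhl : 0 <= h <= h by rewrite lexx ltW.
pose g x := f (x + h *: v); pose p : V -> R := g - f.
have dfT s : 0 <= s <= h ->
    derivable g (a + s *: u) u /\ derivable f (a + s *: u) u.
  move=> sh; split.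
    by apply/derivable_translate/diff_derivable; case: (df s h).
  by apply: diff_derivable; have [] := df s 0 sh h0l; rewrite scale0r addr0.
have [s|s sh] := @MVT_line R V p a u h h0.
  by move=> /dfT[? ?]; exact: derivableB.
have sh' : 0 <= s <= h by case/andP: sh => ? ?; rewrite !ltW.
have -> : 'D_u p (a + s *: u) = 'D_u f (a + s *: u + h *: v) - 'D_u f (a + s *: u).
  have [dg df'] := dfT s sh'.
  by rewrite (deriveB dg df') /g derive_translate.
have [t|t th ->] := @MVT_line R V ('D_u f) (a + s *: u) v h h0.
  by move=> th; apply: diff_derivable; case: (df s t).
have pE x : p x = f (x + h *: v) - f x by [].
rewrite !pE mulrA => E.
exists s, t; split => //; rewrite -E; ring.
Qed.

Lemma small_parallelogram (R : realType) (V : normedModType R) (a u v : V)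
    (d : R) : 0 < d ->
  exists2 h : R, 0 < h & forall s t,
    0 <= s <= h -> 0 <= t <= h -> `|a + s *: u + t *: v - a| < d.
Proof.
(* The summand 1 keeps the constant positive when [u] and [v] vanish and makes the final bound
   strict. *)
move=> d0; have K0 : 0 < `|u| + `|v| + 1 by rewrite ltr_wpDl// addr_ge0.
have [h h0 hK] : exists2 h : R, 0 < h & h * (`|u| + `|v| + 1) = d.
  by exists (d / (`|u| + `|v| + 1)); [exact: divr_gt0|rewrite divfK// gt_eqF].
exists h => // s t /andP[s0 sh] /andP[t0 th].
rewrite -(addrA a) (addrC a) addrK (le_lt_trans (ler_normD _ _))//.
rewrite !normrZ !ger0_norm// -hK !mulrDr mulr1 ltr_pwDr//.
by rewrite lerD// ler_wpM2r.
Qed.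

Lemma near_dist_lt (R : realType) (V : normedModType R) (g : V -> R) (a : V)
    (e : R) :
  0 < e -> {for a, continuous g} -> \forall x \near a, `|g a - g x| < e.
Proof. by move=> e0 cg; exact: (cvgrPdist_lt _ _).1 cg _ e0. Qed.

(** The second difference of [f] over a small parallelogram is symmetric in [u] and [v], and it
    equals [h * h] times either mixed derivative at some point of the parallelogram. Continuity of
    both mixed derivatives at [a] then makes their difference there smaller than any [e]. *)
Lemma derive_sym (R : realType) (V : normedModType R) (f : V -> R) (a u v : V) :
  (\forall x \near a, [/\ differentiable f x, differentiable ('D_u f) x &
                          differentiable ('D_v f) x]) ->
  differentiable ('D_v ('D_u f)) a -> differentiable ('D_u ('D_v f)) a ->
  'D_v ('D_u f) a = 'D_u ('D_v f) a.
Proof.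
move=> nf /differentiable_continuous cvu /differentiable_continuous cuv.
pose fvu : V -> R := 'D_v ('D_u f); pose fuv : V -> R := 'D_u ('D_v f).
have fvuE x : 'D_v ('D_u f) x = fvu x by [].
have fuvE x : 'D_u ('D_v f) x = fuv x by [].
rewrite fvuE fuvE.
have {}cvu : {for a, continuous fvu} by exact: cvu.
have {}cuv : {for a, continuous fuv} by exact: cuv.
clearbody fvu fuv.
apply/eqP; rewrite -subr_eq0 -normr_le0; apply/ler_addgt0Pr => e e0; rewrite add0r.
have e20 : 0 < e / 2 by rewrite divr_gt0.
have nvu := near_dist_lt e20 cvu; have nuv := near_dist_lt e20 cuv.
have [d d0 dP] : exists2 d : R, 0 < d & forall x, `|x - a| < d ->
    [/\ differentiable f x, differentiable ('D_u f) x, differentiable ('D_v f) x,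
     `|fvu a - fvu x| < e / 2 & `|fuv a - fuv x| < e / 2].
  apply: near_norm_lt; near=> x.
  have [? ? ?] : [/\ differentiable f x, differentiable ('D_u f) x &
      differentiable ('D_v f) x] by near: x.
  by split=> //; near: x.
have [h h0 inb] := small_parallelogram a u v d0.
have ltw s : 0 < s < h -> 0 <= s <= h by case/andP=> ? ?; rewrite !ltW.
have [s [t [sh th E1]]] : exists s t : R, [/\ 0 < s < h, 0 < t < h &
    f (a + h *: u + h *: v) - f (a + h *: u) - f (a + h *: v) + f a =
    h * h * 'D_v ('D_u f) (a + s *: u + t *: v)].
  apply: second_difference => // s t sh th.
  by have [] := dP _ (inb _ _ sh th).
have [s' [t' [sh' th' E2]]] : exists s t : R, [/\ 0 < s < h, 0 < t < h &
    f (a + h *: v + h *: u) - f (a + h *: v) - f (a + h *: u) + f a =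
    h * h * 'D_u ('D_v f) (a + s *: v + t *: u)].
  apply: second_difference => // s' t' sh' th'.
  by rewrite addrAC; have [] := dP _ (inb _ _ th' sh').
rewrite fvuE in E1; rewrite fuvE in E2.
have [_ _ _ A1 _] := dP _ (inb _ _ (ltw _ sh) (ltw _ th)).
have [_ _ _ _ A2] := dP _ (inb _ _ (ltw _ th') (ltw _ sh')).
have E : fvu (a + s *: u + t *: v) = fuv (a + t' *: u + s' *: v).
  have hh : h * h != 0 by rewrite mulf_neq0 ?gt_eqF.
  apply: (mulfI hh); rewrite -E1 (addrAC a (t' *: u)) -E2 (addrAC a (h *: v)).
  by rewrite [in LHS](addrAC (f _) (- f (a + h *: u))).
rewrite E in A1; rewrite -(subrKA (fuv (a + t' *: u + s' *: v))).
by rewrite (splitr e) (le_trans (ler_normD _ _))// lerD // ltW // distrC.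
Unshelve. all: by end_near. Qed.

(** * Smooth maps *)

(** Registering scaling as a bilinear map makes the Leibniz rule for [k x *: f x] an instance of the
    differential of a bilinear map. *)
Lemma scale_is_bilinear (R : realType) (W : normedModType R) :
  bilinear_for
    (GRing.Scale.Law.clone _ _ *:%R _) (GRing.Scale.Law.clone _ _ *:%R _)
    (@GRing.scale R W : R -> W -> W).
Proof.
split=> [w a u v|k a u v] /=; first by rewrite scalerDl scalerA.
by rewrite scalerDr scalerA mulrC -scalerA.
Qed.
HB.instance Definition _ (R : realType) (W : normedModType R) :=
  bilinear_isBilinear.Build R R W W _ _ (@GRing.scale R W : R -> W -> W)
    (@scale_is_bilinear R W).

Lemma differentiable_scale (R : realType) (V W : normedModType R)
    (k : V -> R) (f : V -> W) (a : V) :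
  differentiable k a -> differentiable f a ->
  differentiable (fun x => k x *: f x) a.
Proof.
move=> dk df.
have dkf : differentiable (fun x => (k x, f x)) a by exact: differentiable_pair.
have -> : (fun x => k x *: f x) =
  (fun p : R * W => p.1 *: p.2) \o (fun x => (k x, f x)) by [].
apply: differentiable_comp => //.
by apply: differentiable_bilin => p; exact: scale_continuous.
Qed.

Lemma derive_scale (R : realType) (V W : normedModType R)
    (k : V -> R) (f : V -> W) (a v : V) :
  differentiable k a -> differentiable f a ->
  'D_v (fun x => k x *: f x) a = 'D_v k a *: f a + k a *: 'D_v f a.
Proof.
move=> dk df.
have dkf : differentiable (fun x => (k x, f x)) a by exact: differentiable_pair.
have sc : continuous (fun p : R * W => p.1 *: p.2) by move=> p; exact: scale_continuous.
have ds p : differentiable (fun p : R * W => p.1 *: p.2) p.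
  exact: differentiable_bilin.
rewrite deriveE; last exact: differentiable_scale.
have -> : (fun x => k x *: f x) =
  (fun p : R * W => p.1 *: p.2) \o (fun x => (k x, f x)) by [].
rewrite diff_comp //= diff_bilin//= diff_pair//= !deriveE//.
by rewrite addrC.
Qed.

Section SmoothOn.
Variables (R : realType) (m : nat).
Implicit Types (U : set 'rV[R]_m) (W : normedModType R).

(** A fixed set replaces the neighbourhood filter of [smooth_at]: it stays the same at every
    differentiation, so closure arguments need no shrinking. *)
Definition smooth_on W U (f : 'rV[R]_m -> W) : Prop :=
  forall a, U a -> forall vs : seq 'rV[R]_m,
    differentiable (foldr (fun v h => 'D_v h) f vs) a.

Lemma smooth_atP W (f : 'rV[R]_m -> W) a :
  smooth_at f a <-> exists U, [/\ open U, U a & smooth_on U f].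
Proof.
split=> [sf|[U [oU Ua sf]]]; last first.
  by move: (open_nbhs_nbhs (conj oU Ua)); apply: filterS => b /sf.
have : nbhs a [set b | forall vs : seq 'rV[R]_m,
    differentiable (foldr (fun v h => 'D_v h) f vs) b] by [].
rewrite nbhsE => -[U [oU Ua] Us].
by exists U; split => // b /Us.
Qed.

Lemma smooth_on_differentiable W U (f : 'rV[R]_m -> W) a :
  smooth_on U f -> U a -> differentiable f a.
Proof. by move=> sf /sf /(_ [::]). Qed.

Lemma smooth_on_derive W U (f : 'rV[R]_m -> W) v :
  smooth_on U f -> smooth_on U ('D_v f).
Proof. by move=> sf a Ua vs; have := sf a Ua (rcons vs v); rewrite foldr_rcons. Qed.

Lemma smooth_on_subset W U U' (f : 'rV[R]_m -> W) :
  U' `<=` U -> smooth_on U f -> smooth_on U' f.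
Proof. by move=> UU' sf a /UU'; exact: sf. Qed.

(* Proving smoothness coinductively: a family of differentiable functions that
   is closed under directional derivatives consists of smooth functions. *)
Lemma smooth_on_coind W U (P : ('rV[R]_m -> W) -> Prop) : open U ->
  (forall f, P f -> forall a, U a -> differentiable f a) ->
  (forall f v, P f -> exists2 g, P g & forall a, U a -> 'D_v f a = g a) ->
  forall f, P f -> smooth_on U f.
Proof.
move=> oU Pd PD f Pf a Ua vs.
have nU b : U b -> \forall x \near b, U x by move=> Ub; exact: open_nbhs_nbhs.
have [g Pg fg] : exists2 g, P g & forall b, U b ->
    foldr (fun v h => 'D_v h) f vs b = g b.
  elim: vs => [|v vs [g Pg fg]] /=; first by exists f.
  have [h Ph gh] := PD g v Pg; exists h => // b Ub; rewrite -gh//.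
  by apply: near_eq_derive; apply: filterS (nU b Ub) => x /fg.
apply: near_eq_differentiable (Pd g Pg a Ua).
by apply: filterS (nU a Ua) => x /fg.
Qed.

Lemma smooth_on_eq W U (f g : 'rV[R]_m -> W) : open U ->
  (forall a, U a -> f a = g a) -> smooth_on U f -> smooth_on U g.
Proof.
move=> oU fg sf.
have nU b : U b -> \forall x \near b, U x by move=> Ub; exact: open_nbhs_nbhs.
(* Agreement on [U] alone survives differentiation because [U] is open. *)
apply: (@smooth_on_coind _ U (fun h => exists2 k, smooth_on U k &
  forall a, U a -> k a = h a)) => //; last by exists f.
  move=> h [k sk kh] a Ua.
  apply: near_eq_differentiable (smooth_on_differentiable sk Ua).
  by apply: filterS (nU a Ua) => x /kh.
move=> h v [k sk kh]; exists ('D_v k).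
  by exists ('D_v k) => //; exact: smooth_on_derive.
move=> a Ua; apply: near_eq_derive; apply: filterS (nU a Ua) => x Ux.
by rewrite kh.
Qed.

Lemma smooth_on_cst W U (w : W) : open U -> smooth_on U (fun=> w).
Proof.
move=> oU; apply: (@smooth_on_coind _ U (fun h => exists w, h = cst w)) => //.
- by move=> f [c ->] a _; exact: differentiable_cst.
- move=> f v [c ->]; exists (cst 0); first by exists 0.
  by move=> a _; rewrite derive_cst.
- by exists w.
Qed.

(** Products alone are not closed under differentiation, since the Leibniz rule yields a sum; finite
    sums of products are, and so can serve as the coinductive invariant. *)
Inductive scaled_sum (W : normedModType R) U : ('rV[R]_m -> W) -> Prop :=
| ScaledSumScale (k : 'rV[R]_m -> R) (f : 'rV[R]_m -> W) :
    smooth_on U k -> smooth_on U f ->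
    scaled_sum U (fun x => k x *: f x)
| ScaledSumAdd f g : scaled_sum U f -> scaled_sum U g -> scaled_sum U (f + g).

Lemma smooth_on_scaled_sum W U (f : 'rV[R]_m -> W) :
  open U -> scaled_sum U f -> smooth_on U f.
Proof.
move=> oU; apply: smooth_on_coind => //.
  move=> {}f; elim=> [k {}f sk sf a Ua|{}f g _ IHf _ IHg a Ua].
    by apply: differentiable_scale; exact: smooth_on_differentiable Ua.
  by apply: differentiableD; [exact: IHf|exact: IHg].
move=> {}f v sf.
suff [h sh fh] : exists2 h, scaled_sum U h & forall a, U a ->
    differentiable f a /\ 'D_v f a = h a.
  by exists h => // a /fh[].
elim: sf => [k {}f sk sf|{}f g _ [f' sf ff'] _ [g' sg gg']].
  exists ((fun x => 'D_v k x *: f x) + (fun x => k x *: 'D_v f x)).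
    by apply: ScaledSumAdd; apply: ScaledSumScale => //; exact: smooth_on_derive.
  move=> a Ua; have dk := smooth_on_differentiable sk Ua.
  have df := smooth_on_differentiable sf Ua.
  by split; [exact: differentiable_scale|exact: derive_scale].
exists (f' + g'); first exact: ScaledSumAdd.
move=> a Ua; have [df Df] := ff' a Ua; have [dg Dg] := gg' a Ua.
split; first exact: differentiableD.
by rewrite (deriveD (diff_derivable df) (diff_derivable dg)) Df Dg.
Qed.

Lemma smooth_on_scale W U (k : 'rV[R]_m -> R) (f : 'rV[R]_m -> W) : open U ->
  smooth_on U k -> smooth_on U f -> smooth_on U (fun x => k x *: f x).
Proof. by move=> oU sk sf; exact/smooth_on_scaled_sum/ScaledSumScale. Qed.

Lemma smooth_on_add W U (f g : 'rV[R]_m -> W) : open U ->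
  smooth_on U f -> smooth_on U g -> smooth_on U (f + g).
Proof.
move=> oU sf sg; apply: smooth_on_scaled_sum => //.
(* The constant coefficient 1 turns a sum of two smooth functions into a scaled sum. *)
have E (h : 'rV[R]_m -> W) : h = fun x => (fun=> 1 : R) x *: h x.
  by apply/funext => x; rewrite scale1r.
rewrite (E f) (E g).
by apply: ScaledSumAdd; apply: ScaledSumScale => //; exact: smooth_on_cst.
Qed.

Lemma smooth_on_linear W U (f : {linear 'rV[R]_m -> W}) : open U ->
  continuous f -> smooth_on U f.
Proof.
move=> oU cf; have df a : differentiable f a by exact: linear_differentiable.
(* The directional derivatives of a linear map are constant, so adjoining the constants closes the
   family. *)
apply: (@smooth_on_coind _ U (fun h => h = f \/ exists w, h = cst w)) => //.
- by move=> g [->|[w ->]] a _; [exact: df|exact: differentiable_cst].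
- move=> g v [->|[w ->]].
    exists (cst (f v)); first by right; exists (f v).
    by move=> a _; rewrite deriveE// diff_lin.
  exists (cst 0); first by right; exists 0.
  by move=> a _; rewrite derive_cst.
- by left.
Qed.

End SmoothOn.

Lemma row_derive (R : realType) (m : nat) (W : normedModType R)
    (f : 'rV[R]_m -> W) (a u : 'rV[R]_m) :
  differentiable f a ->
  'D_u f a = \sum_i u 0 i *: 'D_(delta_mx 0 i) f a.
Proof.
move=> df; rewrite deriveE// [in LHS](row_sum_delta u) linear_sum /=.
by apply: eq_bigr => i _; rewrite linearZ /= deriveE.
Qed.

Lemma smooth_on_linear_comp (R : realType) (m : nat) (V W : normedModType R)
    (U : set 'rV[R]_m) (L : {linear V -> W}) (g : 'rV[R]_m -> V) :
  open U -> continuous L -> smooth_on U g -> smooth_on U (L \o g).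
Proof.
move=> oU cL sg; have dL a : differentiable L a by exact: linear_differentiable.
apply: (@smooth_on_coind _ _ _ U (fun h => exists2 g, smooth_on U g & h = L \o g)) => //.
- move=> f [h sh ->] a Ua.
  by apply: differentiable_comp => //; exact: smooth_on_differentiable sh Ua.
- move=> f v [h sh ->]; exists (L \o 'D_v h).
    by exists ('D_v h) => //; exact: smooth_on_derive.
  move=> a Ua; rewrite derive_comp//; last exact: smooth_on_differentiable sh Ua.
  by rewrite deriveE// diff_lin.
- by exists g.
Qed.

Definition row_coord (R : realType) (m : nat) (i : 'I_m) (x : 'rV[R]_m) : R :=
  x 0 i.

Lemma row_coord_is_linear (R : realType) (m : nat) (i : 'I_m) :
  linear (@row_coord R m i).
Proof. by move=> k x y; rewrite /row_coord !mxE. Qed.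
HB.instance Definition _ (R : realType) (m : nat) (i : 'I_m) :=
  GRing.isLinear.Build _ _ _ _ (@row_coord R m i) (@row_coord_is_linear R m i).

Lemma row_coord_continuous (R : realType) (m : nat) (i : 'I_m) :
  continuous (@row_coord R m i).
Proof. exact: coord_continuous. Qed.

(** * Composition of smooth maps *)

Section SmoothComp.
Variables (R : realType) (m k : nat) (W : normedModType R).
Variables (U : set 'rV[R]_m) (V : set 'rV[R]_k) (g : 'rV[R]_m -> 'rV[R]_k).

(** By the chain rule, f o g is differentiated in the direction ['D_v g x], which varies with [x].
    Expanding it in the standard basis leaves derivatives of f in fixed directions, with smooth
    coefficients; sums of terms [c x *: f (g x)] are therefore closed under differentiation. *)
Inductive comp_sum : ('rV[R]_m -> W) -> Prop :=
| CompSumScale (c : 'rV[R]_m -> R) (f : 'rV[R]_k -> W) :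
    smooth_on U c -> smooth_on V f -> comp_sum (fun x => c x *: f (g x))
| CompSumAdd f h : comp_sum f -> comp_sum h -> comp_sum (f + h).

Hypotheses (oU : open U) (oV : open V) (sg : smooth_on U g).
Hypothesis (gUV : forall a, U a -> V (g a)).

Lemma comp_sum_sum (I : finType) (f : I -> 'rV[R]_m -> W) :
  (forall i, comp_sum (f i)) -> comp_sum (\sum_i f i).
Proof.
move=> sf; apply: (@big_ind _ comp_sum) => //; last exact: CompSumAdd.
have -> : 0 = (fun x => (cst 0 : 'rV[R]_m -> R) x *: (cst 0 : 'rV[R]_k -> W) (g x)).
  by apply/funext => x; rewrite scale0r.
by apply: CompSumScale; exact: smooth_on_cst.
Qed.

Lemma smooth_on_comp_sum (f : 'rV[R]_m -> W) : comp_sum f -> smooth_on U f.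
Proof.
apply: smooth_on_coind => //.
  move=> {}f; elim=> [c {}f sc sf a Ua|{}f h _ IHf _ IHh a Ua].
    apply: differentiable_scale; first exact: smooth_on_differentiable sc Ua.
    apply: (@differentiable_comp _ _ _ _ g f).
      exact: smooth_on_differentiable sg Ua.
    exact: smooth_on_differentiable sf (gUV Ua).
  by apply: differentiableD; [exact: IHf|exact: IHh].
move=> {}f v sf.
suff [h sh fh] : exists2 h, comp_sum h & forall a, U a ->
    differentiable f a /\ 'D_v f a = h a.
  by exists h => // a /fh[].
elim: sf => [c {}f sc sf|{}f h _ [f' sf ff'] _ [h' sh hh']].
  exists ((fun x => 'D_v c x *: f (g x)) +
    \sum_i (fun x => (c x *: row_coord i ('D_v g x)) *: 'D_(delta_mx 0 i) f (g x))).
    apply: CompSumAdd; first by apply: CompSumScale => //; exact: smooth_on_derive.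
    apply: comp_sum_sum => i.
    apply: (@CompSumScale (fun x => c x *: row_coord i ('D_v g x))
      ('D_(delta_mx 0 i) f)); last exact: smooth_on_derive.
    apply: smooth_on_scale => //.
    apply: (@smooth_on_linear_comp _ _ _ _ _ (@row_coord R k i)) => //.
      exact: row_coord_continuous.
    exact: smooth_on_derive.
  move=> a Ua; have dc := smooth_on_differentiable sc Ua.
  have dg := smooth_on_differentiable sg Ua.
  have df := smooth_on_differentiable sf (gUV Ua).
  have dfg : differentiable (f \o g) a by exact: differentiable_comp.
  split; first exact: (@differentiable_scale _ _ _ c (f \o g)).
  rewrite (@derive_scale _ _ _ c (f \o g))// (derive_comp v dg df) (row_derive _ df).
  rewrite scaler_sumr [RHS]/= fct_sumE; congr (_ + _).
  by apply: eq_bigr => i _; rewrite scalerA.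
exists (f' + h'); first exact: CompSumAdd.
move=> a Ua; have [df Df] := ff' a Ua; have [dh Dh] := hh' a Ua.
split; first exact: differentiableD.
by rewrite (deriveD (diff_derivable df) (diff_derivable dh)) Df Dh.
Qed.

Lemma smooth_on_comp (f : 'rV[R]_k -> W) : smooth_on V f -> smooth_on U (f \o g).
Proof.
move=> sf; apply: smooth_on_comp_sum.
have -> : f \o g = fun x => (cst 1 : 'rV[R]_m -> R) x *: f (g x).
  by apply/funext => x /=; rewrite scale1r.
by apply: CompSumScale => //; exact: smooth_on_cst.
Qed.

End SmoothComp.

(** * Smoothness at a point *)

Section SmoothAt.
Variables (R : realType) (m : nat).
Implicit Types (W : normedModType R) (a : 'rV[R]_m).

Lemma smooth_at_differentiable W (f : 'rV[R]_m -> W) a :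
  smooth_at f a -> differentiable f a.
Proof. by move=> /smooth_atP[U [oU Ua sf]]; exact: smooth_on_differentiable sf Ua. Qed.

Lemma smooth_at_near W (f : 'rV[R]_m -> W) a :
  smooth_at f a -> \forall x \near a, smooth_at f x.
Proof.
move=> /smooth_atP[U [oU Ua sf]].
by apply: filterS (open_nbhs_nbhs (conj oU Ua)) => x Ux; apply/smooth_atP; exists U.
Qed.

Lemma smooth_at_derive W (f : 'rV[R]_m -> W) a v :
  smooth_at f a -> smooth_at ('D_v f) a.
Proof.
move=> /smooth_atP[U [oU Ua sf]]; apply/smooth_atP; exists U; split => //.
exact: smooth_on_derive.
Qed.

Lemma near_eq_smooth_at W (f g : 'rV[R]_m -> W) a :
  (\forall x \near a, f x = g x) -> smooth_at f a -> smooth_at g a.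
Proof.
move=> fg /smooth_atP[U [oU Ua sf]]; apply/smooth_atP.
have : nbhs a [set x | f x = g x] by [].
rewrite nbhsE => -[U' [oU' U'a] U'fg].
exists (U `&` U'); split => //; first exact: openI.
apply: (smooth_on_eq (openI oU oU') (f := f)) => [x [_ /U'fg]//|].
by apply: smooth_on_subset sf => x [].
Qed.

Lemma smooth_at_cst W (w : W) a : smooth_at (fun=> w) a.
Proof.
apply/smooth_atP; exists setT; split => //; first exact: openT.
exact/smooth_on_cst/openT.
Qed.

Lemma smooth_at_scale W (c : 'rV[R]_m -> R) (f : 'rV[R]_m -> W) a :
  smooth_at c a -> smooth_at f a -> smooth_at (fun x => c x *: f x) a.
Proof.
move=> /smooth_atP[U [oU Ua sc]] /smooth_atP[U' [oU' U'a sf]].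
apply/smooth_atP; exists (U `&` U'); split => //; first exact: openI.
apply: smooth_on_scale; first exact: openI.
  by apply: smooth_on_subset sc => x [].
by apply: smooth_on_subset sf => x [].
Qed.

Lemma smooth_at_add W (f g : 'rV[R]_m -> W) a :
  smooth_at f a -> smooth_at g a -> smooth_at (f + g) a.
Proof.
move=> /smooth_atP[U [oU Ua sc]] /smooth_atP[U' [oU' U'a sf]].
apply/smooth_atP; exists (U `&` U'); split => //; first exact: openI.
apply: smooth_on_add; first exact: openI.
  by apply: smooth_on_subset sc => x [].
by apply: smooth_on_subset sf => x [].
Qed.

Lemma smooth_at_sum W (I : finType) (f : I -> 'rV[R]_m -> W) a :
  (forall i, smooth_at (f i) a) -> smooth_at (\sum_i f i) a.
Proof.
move=> sf; apply: (@big_ind _ (fun g => smooth_at g a)) => //.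
  exact: smooth_at_cst.
by move=> *; exact: smooth_at_add.
Qed.

Lemma smooth_at_linear_comp (V W : normedModType R) (L : {linear V -> W})
    (g : 'rV[R]_m -> V) a :
  continuous L -> smooth_at g a -> smooth_at (L \o g) a.
Proof.
move=> cL /smooth_atP[U [oU Ua sg]]; apply/smooth_atP; exists U; split => //.
exact: smooth_on_linear_comp.
Qed.

Lemma smooth_at_linear W (L : {linear 'rV[R]_m -> W}) a :
  continuous L -> smooth_at L a.
Proof.
move=> cL; apply/smooth_atP; exists setT; split => //; first exact: openT.
exact: smooth_on_linear openT cL.
Qed.

Lemma smooth_at_comp (k : nat) W (f : 'rV[R]_k -> W)
    (g : 'rV[R]_m -> 'rV[R]_k) a :
  smooth_at g a -> smooth_at f (g a) -> smooth_at (f \o g) a.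
Proof.
move=> sg /smooth_atP[V [oV Vga sf]].
have cg := differentiable_continuous (smooth_at_differentiable sg).
have [U1 [oU1 U1a sg1]] := (smooth_atP _ _).1 sg.
have : nbhs a (g @^-1` V) by exact: cg (open_nbhs_nbhs (conj oV Vga)).
rewrite nbhsE => -[U2 [oU2 U2a] U2V].
apply/smooth_atP; exists (U1 `&` U2); split => //; first exact: openI.
apply: (@smooth_on_comp _ _ _ _ _ V) => //; first exact: openI.
- by apply: smooth_on_subset sg1 => x [].
- by move=> x [_ /U2V].
Qed.

End SmoothAt.

Lemma smooth_at_derive_sym (R : realType) (m : nat) (f : 'rV[R]_m -> R)
    (a u v : 'rV[R]_m) :
  smooth_at f a -> 'D_v ('D_u f) a = 'D_u ('D_v f) a.
Proof.
move=> sf; apply: derive_sym.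
- apply: filterS (smooth_at_near sf) => x sx.
  by split; apply: smooth_at_differentiable => //; exact: smooth_at_derive.
- by apply: smooth_at_differentiable; do 2!apply: smooth_at_derive.
- by apply: smooth_at_differentiable; do 2!apply: smooth_at_derive.
Qed.

Lemma smooth_at_row (R : realType) (m k : nat) (f : 'rV[R]_m -> 'rV[R]_k)
    (a : 'rV[R]_m) :
  (forall i, smooth_at (fun x => f x 0 i) a) -> smooth_at f a.
Proof.
move=> sf.
have -> : f = \sum_i (fun x => f x 0 i *: (cst (delta_mx 0 i) : 'rV[R]_m -> 'rV[R]_k) x).
  by apply/funext => x; rewrite fct_sumE [LHS]row_sum_delta.
by apply: smooth_at_sum => i; apply: smooth_at_scale => //; exact: smooth_at_cst.
Qed.

Lemma smooth_at_coord (R : realType) (m k : nat) (f : 'rV[R]_m -> 'rV[R]_k)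
    (a : 'rV[R]_m) i : smooth_at f a -> smooth_at (fun x => f x 0 i) a.
Proof.
exact: (smooth_at_linear_comp (L := @row_coord R k i) (@row_coord_continuous R k i)).
Qed.

Lemma smooth_at_lsubmx (R : realType) (m k : nat) (a : 'rV[R]_(m + k)) :
  smooth_at (lsubmx : 'rV[R]_(m + k) -> 'rV[R]_m) a.
Proof. by apply: smooth_at_linear => x; exact: continuous_lsubmx. Qed.

Lemma smooth_at_rsubmx (R : realType) (m k : nat) (a : 'rV[R]_(m + k)) :
  smooth_at (rsubmx : 'rV[R]_(m + k) -> 'rV[R]_k) a.
Proof. by apply: smooth_at_linear => x; exact: continuous_rsubmx. Qed.

(** Linearity makes the two difference quotients the same function. The identity thus holds at every
    point and can be differentiated once more, as the fibre Hessian requires. *)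
Lemma derive_linear_comp (R : realType) (U V W : normedModType R)
    (f : V -> W) (L : {linear U -> V}) (a v : U) :
  'D_v (f \o L) a = 'D_(L v) f (L a).
Proof.
rewrite /derive; set p := fun h => _; set q := fun h => _; suff -> : p = q by [].
apply/funext => h; have E : L (h *: v + a) = h *: L v + L a by rewrite linearP.
by rewrite /p /q /= E.
Qed.

Lemma derive_row_mx (R : realType) (m k : nat) (W : normedModType R)
    (f : 'rV[R]_(m + k) -> W) (x : 'rV[R]_m) (a v : 'rV[R]_k) :
  'D_v (f \o row_mx x) a = 'D_(row_mx 0 v) f (row_mx x a).
Proof.
rewrite /derive; set p := fun h => _; set q := fun h => _; suff -> : p = q by [].
by apply/funext => h; rewrite /p /q /= scale_row_mx scaler0 add_row_mx add0r.
Qed.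

Lemma smooth_at_row_mx (R : realType) (m k : nat) (x : 'rV[R]_m) (a : 'rV[R]_k) :
  smooth_at (row_mx x) a.
Proof.
apply: smooth_at_row => i; case: (split_ordP i) => j ->.
  have -> : (fun y : 'rV[R]_k => row_mx x y 0 (lshift k j)) = fun=> x 0 j.
    by apply/funext => y; rewrite row_mxEl.
  exact: smooth_at_cst.
have -> : (fun y : 'rV[R]_k => row_mx x y 0 (rshift m j)) = row_coord j.
  by apply/funext => y; rewrite row_mxEr.
by apply: smooth_at_linear; exact: row_coord_continuous.
Qed.

Lemma derive2_row (R : realType) (m : nat) (f : 'rV[R]_m -> R)
    (a u v : 'rV[R]_m) : smooth_at f a ->
  'D_u ('D_v f) a = \sum_i \sum_j
     u 0 i * ('D_(delta_mx 0 i) ('D_(delta_mx 0 j) f) a * v 0 j).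
Proof.
move=> sf; have dD w : differentiable ('D_w f) a.
  exact/smooth_at_differentiable/smooth_at_derive.
(* [row_derive] expands only the outer direction, so symmetry brings [v] outside, and a second use
   restores the order. *)
rewrite row_derive//; apply: eq_bigr => i _; rewrite smooth_at_derive_sym//.
rewrite row_derive// scaler_sumr; apply: eq_bigr => j _.
by rewrite smooth_at_derive_sym// [_ * v 0 j]mulrC.
Qed.

(** * Charts of a manifold and of its tangent bundle *)

(* The axioms of a smooth manifold that are inherited by the tangent bundle
   without any topological argument. *)
Record smooth_charts (R : realType) (n : nat) (M : atlas R n) : Prop := {
  charts_atP : forall p : M, dom (chart_at p) p;
  charts_phiK : forall (c : chart M) (p : M), dom c p -> psi c (phi c p) = p;
  charts_open_overlap : forall c c' : chart M,
    open (phi c @` (dom c `&` dom c'));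
  charts_transition : forall (c c' : chart M) (p : M), dom c p -> dom c' p ->
    smooth_at (phi c' \o psi c) (phi c p) }.

Lemma manifold_smooth_charts (R : realType) (n : nat) (M : atlas R n) :
  smooth_manifold M -> smooth_charts M.
Proof. by case. Qed.

Section Charts.
Variables (R : realType) (n : nat) (M : atlas R n).
Hypothesis hM : smooth_charts M.
Implicit Types (c : chart M) (p q : M) (u v : 'rV[R]_n).

Lemma near_chart c c' p : dom c p -> dom c' p ->
  \forall a \near phi c p,
    [/\ dom c (psi c a), dom c' (psi c a) & phi c (psi c a) = a].
Proof.
move=> cp c'p.
have := open_nbhs_nbhs (conj (@charts_open_overlap _ _ _ hM c c')
  (imageP (phi c) (conj cp c'p))).
by apply: filterS => _ [q [cq c'q] <-]; rewrite (charts_phiK hM).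
Qed.

Lemma transition_differentiable c c' p : dom c p -> dom c' p ->
  differentiable (phi c' \o psi c) (phi c p).
Proof. by move=> cp c'p; exact/smooth_at_differentiable/charts_transition. Qed.

(** The cocycle law for the Jacobians of transition maps. The transition maps themselves compose
    only near [phi c p], where [psi c] stays in [dom c'], which is enough for derivatives. *)
Lemma derive_transition c c' c'' p v : dom c p -> dom c' p -> dom c'' p ->
  'D_('D_v (phi c' \o psi c) (phi c p)) (phi c'' \o psi c') (phi c' p) =
  'D_v (phi c'' \o psi c) (phi c p).
Proof.
move=> cp c'p c''p.
have E : phi c' p = (phi c' \o psi c) (phi c p) by rewrite /= (charts_phiK hM).
rewrite [in X in derive _ X _]E -derive_comp; first last.
- by rewrite -E; exact: transition_differentiable.
- exact: transition_differentiable.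
apply: near_eq_derive; apply: filterS (near_chart cp c'p) => a [ca c'a _] /=.
by rewrite (charts_phiK hM).
Qed.

Lemma derive_transition_id c p v : dom c p -> 'D_v (phi c \o psi c) (phi c p) = v.
Proof.
move=> cp; rewrite -[RHS](derive_id (phi c p)).
by apply: near_eq_derive; apply: filterS (near_chart cp cp) => a [].
Qed.

Lemma vec_coord_of_coord c c' p u : dom c p -> dom c' p ->
  vec_coord c' p (vec_of_coord c p u) = 'D_u (phi c' \o psi c) (phi c p).
Proof.
by move=> cp c'p; rewrite /vec_coord derive_transition//; exact: charts_atP.
Qed.

Lemma vec_of_coordK c p u : dom c p -> vec_coord c p (vec_of_coord c p u) = u.
Proof. by move=> cp; rewrite vec_coord_of_coord// derive_transition_id. Qed.

Lemma vec_coordK c p u : dom c p -> vec_of_coord c p (vec_coord c p u) = u.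
Proof.
move=> cp; have cpp := charts_atP hM p.
by rewrite /vec_of_coord /vec_coord derive_transition// derive_transition_id.
Qed.

Lemma vec_coord_at p u : vec_coord (chart_at p) p u = u.
Proof. exact/derive_transition_id/charts_atP. Qed.

Lemma vec_of_coord_at p u : vec_of_coord (chart_at p) p u = u.
Proof. exact/derive_transition_id/charts_atP. Qed.

Lemma vec_of_coord_linear c p : dom c p -> linear (vec_of_coord c p).
Proof.
move=> cp k u v; apply: derive_dirD.
by apply: transition_differentiable => //; exact: charts_atP.
Qed.

Lemma extend_vec_at p v : extend_vec p v p = v.
Proof. exact: vec_of_coord_at. Qed.

Lemma near_extend_vec p v :
  \forall a \near phi (chart_at p) p,
    vec_coord (chart_at p) (psi (chart_at p) a)
      (extend_vec p v (psi (chart_at p) a)) = v.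
Proof.
have cp := charts_atP hM p.
by apply: filterS (near_chart cp cp) => a [ca _ _]; rewrite vec_of_coordK.
Qed.

Lemma extend_vec_smooth p v : smooth_vfield_at (extend_vec p v) p.
Proof.
apply: near_eq_smooth_at (smooth_at_cst v _).
by apply: filterS (near_extend_vec p v) => a E; rewrite /= E.
Qed.

Lemma bracket_extend_vec p u v :
  bracket (extend_vec p u) (extend_vec p v) p = 0.
Proof.
have D0 w w' : vec_deriv p w (fun q => vec_coord (chart_at p) q (extend_vec p w' q)) = 0.
  rewrite -[RHS](derive_cst w' (phi (chart_at p) p) w).
  by apply: near_eq_derive; exact: near_extend_vec.
by rewrite /bracket !D0 subrr.
Qed.

(** [vec_deriv] at a point uses the chart chosen there, and that choice need not vary continuously.
    Passing to one chart [c] makes a derivative along a field differentiable in the base point. *)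
Lemma vec_deriv_of_coord (W : normedModType R) c p v (f : M -> W) : dom c p ->
  differentiable (f \o psi c) (phi c p) ->
  vec_deriv p (vec_of_coord c p v) f = 'D_v (f \o psi c) (phi c p).
Proof.
move=> cp df; have cpp := charts_atP hM p.
have E : phi (chart_at p) p = (phi (chart_at p) \o psi c) (phi c p).
  by rewrite /= (charts_phiK hM).
have E' : (phi c \o psi (chart_at p)) (phi (chart_at p) p) = phi c p.
  by rewrite /= (charts_phiK hM).
have -> : 'D_v (f \o psi c) (phi c p) =
    'D_(vec_coord c p (vec_of_coord c p v)) (f \o psi c) (phi c p).
  by rewrite vec_of_coordK.
rewrite /vec_coord -E' -derive_comp; first last.
- by rewrite E'.
- exact: transition_differentiable.
apply: near_eq_derive; apply: filterS (near_chart cpp cp) => a [_ ca _] /=.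
by rewrite (charts_phiK hM).
Qed.

(** With constant components no first-order term appears, and iterated derivatives along fields
    become second directional derivatives in one chart, to which symmetry applies. *)
Lemma vec_deriv_extend_vec2 p u v (f : M -> R) :
  smooth_at (f \o psi (chart_at p)) (phi (chart_at p) p) ->
  vec_deriv p u (fun q => vec_deriv q (extend_vec p v q) f) =
  'D_u ('D_v (f \o psi (chart_at p))) (phi (chart_at p) p).
Proof.
move=> sf; have cp := charts_atP hM p.
apply: near_eq_derive.
have := smooth_at_near sf; apply: filterS2 (near_chart cp cp) => a [ca _ Ea] sa /=.
by rewrite /extend_vec vec_deriv_of_coord ?Ea//; exact: smooth_at_differentiable.
Qed.

End Charts.

Lemma smooth_fun_at_chart (R : realType) (n : nat) (M : atlas R n)
    (W : normedModType R) (f : M -> W) (c : chart M) (p : M) :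
  smooth_charts M -> smooth_fun_at f p -> dom c p ->
  smooth_at (f \o psi c) (phi c p).
Proof.
move=> hM sf cp; have cpp := charts_atP hM p.
have : smooth_at ((f \o psi (chart_at p)) \o (phi (chart_at p) \o psi c)) (phi c p).
  apply: smooth_at_comp; first exact: charts_transition.
  by rewrite /= (charts_phiK hM).
apply: near_eq_smooth_at; apply: filterS (near_chart hM cp cpp) => a [_ ca _] /=.
by rewrite (charts_phiK hM).
Qed.

(** * Smooth charts of the tangent bundle *)

Section TangentBundle.
Variables (R : realType) (n : nat) (M : atlas R n).
Hypothesis hM : smooth_charts M.

(** A transition of the bundle is (x, y) |-> (tau x, Dtau(x) y). Its second half is the sum of the
    y_i times the partial derivatives of tau at x, hence smooth in both variables. *)
Lemma tangent_bundle_smooth_charts : smooth_charts (tangent_bundle M).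
Proof.
have lsub_open (A : set 'rV[R]_n) : open A -> open ((@lsubmx R 1 n n) @^-1` A).
  by apply: open_comp => x _; exact: continuous_lsubmx.
(* Fibre coordinates are unrestricted, so an overlap of bundle charts is a cylinder over the overlap
   in the base. *)
have E (c c' : chart M) : @phi R (n + n) (tangent_bundle M) c @`
    (@dom R (n + n) (tangent_bundle M) c `&` @dom R (n + n) (tangent_bundle M) c') =
    (@lsubmx R 1 n n) @^-1` (phi c @` (dom c `&` dom c')).
  apply/seteqP; split=> [_ [[p v] [/= cp c'p] <-]|a [p [cp c'p] pa]] /=.
    by exists p => //; rewrite row_mxKl.
  exists (p, vec_of_coord c p (rsubmx a)) => //=.
  by rewrite vec_of_coordK// pa hsubmxK.
split.
- by move=> [p v]; exact: (charts_atP hM).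
- by move=> c [p v] cp /=; rewrite row_mxKl row_mxKr (charts_phiK hM)// vec_coordK.
- by move=> c c'; rewrite E; apply: lsub_open; exact: charts_open_overlap.
- suff H (c c' : chart M) (p : M) (v : 'rV[R]_n) : dom c p -> dom c' p ->
      smooth_at (@phi R (n + n) (tangent_bundle M) c' \o
                 @psi R (n + n) (tangent_bundle M) c)
        (row_mx (phi c p) (vec_coord c p v)).
    by move=> c c' [p v]; exact: H.
  move=> cp c'p; pose tau := phi c' \o psi c.
  set z := row_mx _ _.
  have zl : lsubmx z = phi c p by rewrite row_mxKl.
  have stau : smooth_at (tau \o lsubmx) z.
    apply: smooth_at_comp; first exact: smooth_at_lsubmx.
    by rewrite zl; exact: charts_transition.
  have sDtau : smooth_at (\sum_(i < n) (fun a : 'rV[R]_(n + n) =>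
      rsubmx a 0 i *: ('D_(delta_mx 0 i) tau \o lsubmx) a)) z.
    apply: smooth_at_sum => i; apply: smooth_at_scale.
      exact/smooth_at_coord/smooth_at_rsubmx.
    apply: smooth_at_comp; first exact: smooth_at_lsubmx.
    by rewrite zl; apply: smooth_at_derive; exact: charts_transition.
  have near_z : \forall a \near z, [/\ dom c (psi c (lsubmx a)),
      dom c' (psi c (lsubmx a)) & phi c (psi c (lsubmx a)) = lsubmx a].
    have := near_chart hM cp c'p; rewrite -zl => nz.
    exact: (@continuous_lsubmx R 1 n n z _ nz).
  pose G a := row_mx ((tau \o lsubmx) a) ((\sum_(i < n) (fun a : 'rV[R]_(n + n) =>
      rsubmx a 0 i *: ('D_(delta_mx 0 i) tau \o lsubmx) a)) a).
  apply: (@near_eq_smooth_at _ _ _ G).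
    apply: filterS near_z => a [ca c'a Ea].
    rewrite /G /= vec_coord_of_coord// Ea fct_sumE; congr (row_mx _ _).
    rewrite [RHS]row_derive//; last by rewrite -Ea; exact: transition_differentiable.
  apply: smooth_at_row => i; case: (split_ordP i) => j ->.
    have -> : (fun x => G x 0 (lshift n j)) = (fun x => (tau \o lsubmx) x 0 j).
      by apply/funext => x; rewrite /G row_mxEl.
    exact: smooth_at_coord.
  have -> : (fun x => G x 0 (rshift n j)) = (fun x => (\sum_(i < n) (fun a : 'rV[R]_(n + n) =>
      rsubmx a 0 i *: ('D_(delta_mx 0 i) tau \o lsubmx) a)) x 0 j).
    by apply/funext => x; rewrite /G row_mxEr.
  exact: smooth_at_coord.
Qed.

End TangentBundle.

(** * Pi-vector fields in coordinates *)

Section Pivfields.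
Variables (R : realType) (n : nat) (M : atlas R n).
Hypothesis hM : smooth_charts M.
Let TM := tangent_bundle M.
Let hTM : smooth_charts TM := tangent_bundle_smooth_charts hM.

(** Points [w] other than [z] matter because metricity is applied around [z]. In the chart at [w]
    the components are the Jacobian of a transition map applied to [u], pulled back from the
    base. *)
Lemma extend_pivec_smooth (z w : TM) u :
  dom (chart_at z.1) w.1 -> smooth_pivfield_at (extend_pivec z u) w.
Proof.
move=> zw; have ww := charts_atP hM w.1.
pose c := chart_at z.1; pose cw := chart_at w.1.
have wl : lsubmx (@phi _ _ TM cw w) = phi cw w.1 by rewrite row_mxKl.
have : smooth_at ('D_u (phi cw \o psi c) \o ((phi c \o psi cw) \o lsubmx))
    (@phi _ _ TM cw w).
  apply: smooth_at_comp.
    apply: smooth_at_comp; first exact: smooth_at_lsubmx.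
    by rewrite wl; exact: charts_transition.
  have -> : ((phi c \o psi cw) \o lsubmx) (@phi _ _ TM cw w) = phi c w.1.
    by rewrite /= row_mxKl (charts_phiK hM).
  by apply: smooth_at_derive; exact: charts_transition.
apply: near_eq_smooth_at.
have := @near_chart _ _ _ hTM cw c w ww zw; apply: filterS => a [/= wa za _].
by rewrite [RHS]vec_coord_of_coord.
Qed.

Lemma extend_pivec_at (z : TM) u : extend_pivec z u z = u.
Proof. exact: vec_of_coord_at. Qed.

(** The chart chosen at [z] is induced by the one chosen at [z.1], and in this pair of charts the
    projection is the linear map [lsubmx]. *)
Lemma bar_lsubmx (z : TM) X : bar z X = lsubmx X.
Proof.
have zz := charts_atP hM z.1; pose c := chart_at z.1.
have -> : lsubmx X = 'D_X (@lsubmx R 1 n n) (@phi _ _ TM c z).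
  rewrite deriveE; last exact: differentiable_lsubmx.
  by rewrite diff_lin// => x; exact: continuous_lsubmx.
apply: near_eq_derive.
have := @near_chart _ _ _ hTM c c z zz zz; apply: filterS => a [_ _ /= E].
by rewrite -[in RHS]E row_mxKl.
Qed.

Lemma extend_pivec_decomp (z w : TM) u : dom (chart_at z.1) w.1 ->
  u = \sum_i vec_coord (chart_at z.1) w.1 u 0 i *: extend_pivec z (delta_mx 0 i) w.
Proof.
move=> zw; rewrite -[LHS](vec_coordK hM _ zw) [X in vec_of_coord _ _ X]row_sum_delta.
have lin := vec_of_coord_linear hM zw.
pose linM := GRing.isLinear.Build _ _ _ _ _ lin.
pose L : {linear _ -> _} := HB.pack (vec_of_coord (chart_at z.1) w.1) linM.
rewrite -[LHS]/(L _) linear_sum; apply: eq_bigr => i _.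
by rewrite linearZ.
Qed.

End Pivfields.

(** * The Finsler metric *)

Section Metric.
Variables (R : realType) (n : nat) (M : atlas R n).
Hypothesis hM : smooth_charts M.
Let TM := tangent_bundle M.
Let hTM : smooth_charts TM := tangent_bundle_smooth_charts hM.
Variables (D : set TM) (F : TM -> R).
Hypothesis hF : finsler_function D F.
Let F2 (w : TM) : R := F w ^+ 2.

Lemma finsler_metricE w u v :
  finsler_metric F w u v = \sum_i \sum_j u 0 i * (finsler_matrix F w i j * v 0 j).
Proof.
rewrite /finsler_metric -mulmxA mxE; apply: eq_bigr => i _.
by rewrite mxE mulr_sumr; apply: eq_bigr => j _; rewrite [v^T _ _]mxE.
Qed.

Lemma finsler_metricDl w u u' v :
  finsler_metric F w (u + u') v = finsler_metric F w u v + finsler_metric F w u' v.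
Proof. by rewrite /finsler_metric !mulmxDl mxE. Qed.

Lemma finsler_metricNl w u v :
  finsler_metric F w (- u) v = - finsler_metric F w u v.
Proof. by rewrite /finsler_metric !mulNmx mxE. Qed.

Lemma finsler_metricBl w u u' v :
  finsler_metric F w (u - u') v = finsler_metric F w u v - finsler_metric F w u' v.
Proof. by rewrite finsler_metricDl finsler_metricNl. Qed.

Lemma finsler_metricZl w k u v :
  finsler_metric F w (k *: u) v = k * finsler_metric F w u v.
Proof. by rewrite /finsler_metric -!scalemxAl mxE. Qed.

Lemma finsler_metric_suml (I : finType) w (u : I -> 'rV[R]_n) v :
  finsler_metric F w (\sum_i u i) v = \sum_i finsler_metric F w (u i) v.
Proof. by rewrite /finsler_metric !mulmx_suml summxE. Qed.

Lemma finsler_metric0l w v : finsler_metric F w 0 v = 0.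
Proof. by rewrite /finsler_metric !mul0mx mxE. Qed.

Lemma smooth_finsler_sqr (c : chart M) w : D w -> dom c w.1 ->
  smooth_at (F2 \o @psi _ _ TM c) (@phi _ _ TM c w).
Proof.
move=> Dw cw.
have sF := @smooth_fun_at_chart _ _ TM _ F c w hTM (finsler_smooth hF Dw) cw.
have -> : F2 \o @psi _ _ TM c = fun a => (F \o @psi _ _ TM c) a *: (F \o @psi _ _ TM c) a.
  by apply/funext => a; rewrite /F2 /= expr2.
exact: smooth_at_scale.
Qed.

Lemma smooth_finsler_fibre w : D w ->
  smooth_at (fun y : 'rV[R]_n => F2 (w.1, y)) w.2.
Proof.
move=> Dw; have ww := charts_atP hM w.1; pose c := chart_at w.1.
have -> : (fun y : 'rV[R]_n => F2 (w.1, y)) =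
    (F2 \o @psi _ _ TM c) \o row_mx (phi c w.1).
  by apply/funext => y; rewrite /= row_mxKl row_mxKr (charts_phiK hM)// vec_of_coord_at.
apply: smooth_at_comp; first exact: smooth_at_row_mx.
have -> : row_mx (phi c w.1) w.2 = @phi _ _ TM c w by rewrite /= vec_coord_at.
exact: smooth_finsler_sqr.
Qed.

Lemma finsler_metric_hessian w u v : D w ->
  finsler_metric F w u v =
  2^-1 * 'D_u ('D_v (fun y : 'rV[R]_n => F2 (w.1, y))) w.2.
Proof.
move=> Dw; rewrite finsler_metricE derive2_row; last exact: smooth_finsler_fibre.
rewrite mulr_sumr; apply: eq_bigr => i _; rewrite mulr_sumr; apply: eq_bigr => j _.
by rewrite mxE !mulrA [2^-1 * _]mulrC.
Qed.

(** The symmetry of g is that of the second derivatives of [F ^+ 2] along the fibre, so it is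
    available over [D] only. *)
Lemma finsler_metricC w u v : D w -> finsler_metric F w u v = finsler_metric F w v u.
Proof.
move=> Dw; have S := smooth_at_derive_sym v u (smooth_finsler_fibre Dw).
exact: etrans (finsler_metric_hessian u v Dw)
  (etrans (congr1 ( *%R 2^-1) S) (esym (finsler_metric_hessian v u Dw))).
Qed.

(* The change of coordinates in a fibre is linear, so the fibre Hessian of
   [F ^+ 2] can be taken in any chart; it is then a partial derivative of the
   smooth function [F ^+ 2] on the tangent bundle, hence smooth itself. *)
Lemma finsler_metric_chart (c : chart M) w a b : D w -> dom c w.1 ->
  finsler_metric F w (vec_of_coord c w.1 a) (vec_of_coord c w.1 b) =
  2^-1 * 'D_(row_mx 0 a) ('D_(row_mx 0 b) (F2 \o @psi _ _ TM c)) (@phi _ _ TM c w).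
Proof.
move=> Dw cw; apply: etrans (finsler_metric_hessian _ _ Dw) (congr1 ( *%R 2^-1) _).
pose linM := GRing.isLinear.Build _ _ _ _ _ (vec_of_coord_linear hM cw).
pose A : {linear 'rV[R]_n -> 'rV[R]_n} := HB.pack (vec_of_coord c w.1) linM.
pose G (y : 'rV[R]_n) := F2 (w.1, y).
have GA : G \o A = (F2 \o @psi _ _ TM c) \o row_mx (phi c w.1).
  by apply/funext => y; rewrite /= row_mxKl row_mxKr (charts_phiK hM).
have E1 : 'D_b (G \o A) = ('D_(A b) G) \o A.
  by apply/funext => y; exact: derive_linear_comp.
have E2 : 'D_b (G \o A) = 'D_(row_mx 0 b) (F2 \o @psi _ _ TM c) \o row_mx (phi c w.1).
  by apply/funext => y; rewrite GA; exact: derive_row_mx.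
rewrite -[X in derive _ X _](vec_coordK hM w.2 cw).
apply: etrans (esym (derive_linear_comp ('D_(A b) G) A _ a)) _.
by rewrite -E1 E2; exact: derive_row_mx.
Qed.

Lemma near_domain (c : chart M) z : D z -> dom c z.1 ->
  \forall a \near @phi _ _ TM c z, [/\ D (@psi _ _ TM c a),
    dom c (@psi _ _ TM c a).1 & @phi _ _ TM c (@psi _ _ TM c a) = a].
Proof.
move=> Dz cz.
have oD : open (@phi _ _ TM c @` (D `&` @dom _ _ TM c)) by exact: (finsler_open hF).
have := open_nbhs_nbhs (conj oD
  (imageP (@phi _ _ TM c) (conj Dz (cz : @dom _ _ TM c z)))).
by apply: filterS => _ [q [Dq cq] <-]; rewrite (@charts_phiK _ _ TM hTM c q cq).
Qed.

Lemma smooth_metric_extend z u v : D z ->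
  smooth_fun_at (fun w => finsler_metric F w (extend_pivec z u w) (extend_pivec z v w)) z.
Proof.
move=> Dz; have zz := charts_atP hM z.1; pose c := chart_at z.1.
apply: (@near_eq_smooth_at _ _ _ (fun a => (fun=> 2^-1 : R) a *:
  'D_(row_mx 0 u) ('D_(row_mx 0 v) (F2 \o @psi _ _ TM c)) a)).
  apply: filterS (near_domain Dz zz) => a [Da ca Ea].
  by have := finsler_metric_chart u v Da ca; rewrite Ea => /esym.
apply: smooth_at_scale; first exact: smooth_at_cst.
by do 2!apply: smooth_at_derive; exact: smooth_finsler_sqr.
Qed.

(** Needed for covariant derivatives, whose components vary: expansion in the coordinate frame
    reduces to fields with constant components. *)
Lemma smooth_metric z (U V : TM -> 'rV[R]_n) : D z ->
  smooth_pivfield_at U z -> smooth_pivfield_at V z ->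
  smooth_fun_at (fun w => finsler_metric F w (U w) (V w)) z.
Proof.
move=> Dz sU sV; have zz := charts_atP hM z.1; pose c := chart_at z.1.
pose E i := extend_pivec z (delta_mx 0 i : 'rV[R]_n).
apply: (@near_eq_smooth_at _ _ _ (\sum_i (fun a =>
  vec_coord c (@psi _ _ TM c a).1 (U (@psi _ _ TM c a)) 0 i *:
  (\sum_j (fun a => vec_coord c (@psi _ _ TM c a).1 (V (@psi _ _ TM c a)) 0 j *:
    finsler_metric F (@psi _ _ TM c a) (E j (@psi _ _ TM c a))
      (E i (@psi _ _ TM c a)))) a))).
  apply: filterS (near_domain Dz zz) => a [Da ca _] /=.
  set w := @psi _ _ TM c a; rewrite fct_sumE.
  rewrite [in RHS](@extend_pivec_decomp _ _ _ hM z w (U w) ca) finsler_metric_suml.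
  apply: eq_bigr => i _; rewrite finsler_metricZl fct_sumE; congr (_ * _).
  (* Symmetry moves the second argument to the left, where it is expanded by linearity; this is why
     [E j] precedes [E i] above. *)
  rewrite (finsler_metricC _ _ Da) [in RHS](@extend_pivec_decomp _ _ _ hM z w (V w) ca).
  by rewrite finsler_metric_suml; apply: eq_bigr => j _; rewrite finsler_metricZl.
apply: smooth_at_sum => i; apply: smooth_at_scale; first exact: smooth_at_coord sU.
apply: smooth_at_sum => j; apply: smooth_at_scale; first exact: smooth_at_coord sV.
exact: smooth_metric_extend.
Qed.

Lemma finsler_metric_nondegenerate w u : D w ->
  (forall v, finsler_metric F w u v = 0) -> u = 0.
Proof.
move=> Dw g0; rewrite -(mulmxK (finsler_nondegenerate hF Dw) u).
suff -> : u *m finsler_matrix F w = 0 by rewrite mul0mx.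
apply/rowP => j; have := g0 (delta_mx 0 j); rewrite /finsler_metric.
by rewrite trmx_delta -colE !mxE.
Qed.

End Metric.

(** * Symmetries of the h-curvature *)

(** Of the four cyclic identities, the sum of those starting at [u] and [v] minus the sum of those
    starting at [w] and [t] reduces by skewness to twice the claim. *)
Lemma pair_symmetry (R : realType) (T : Type) (Q : T -> T -> T -> T -> R) :
  (forall u v w t, Q v u w t = - Q u v w t) ->
  (forall u v w t, Q u v t w = - Q u v w t) ->
  (forall u v w t, Q u v w t + Q v w u t + Q w u v t = 0) ->
  forall u v w t, Q u v w t = Q w t u v.
Proof.
move=> a12 a34 cyc u v w t.
have := cyc u v w t; have := cyc v w t u; have := cyc w t u v; have := cyc t u v w.
rewrite (a34 v w u t) (a34 w t u v) (a12 v t w u) (a34 v t u w) (a34 t u v w).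
rewrite (a12 w u t v) (a34 w u v t) (a34 u v w t); lra.
Qed.

Section Curvature.
Variables (R : realType) (n : nat) (M : atlas R n).
Hypothesis hM : smooth_charts M.
Let TM := tangent_bundle M.
Let hTM : smooth_charts TM := tangent_bundle_smooth_charts hM.
Variables (D : set TM) (F : TM -> R) (N : connection M).
Hypothesis hF : finsler_function D F.
Hypothesis hN : cartan_connection D F N.
Let lN : linear_connection D N := (cartan_regular hN).1.

Lemma smooth_extend_pivec_at (z : TM) u : smooth_pivfield_at (extend_pivec z u) z.
Proof. exact: (extend_pivec_smooth hM (z := z) (w := z) u (charts_atP hM z.1)). Qed.

Lemma connection0 z Y : D z -> smooth_pivfield_at Y z -> N z 0 Y = 0.
Proof.
move=> Dz sY; have := connection_linear lN 1 0 0 Dz sY.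
rewrite !scale1r addr0 => E.
by apply: (addrI (N z 0 Y)); rewrite addr0 -E.
Qed.

Definition cov_extend z X u : 'rV[R]_n := N z X (extend_pivec z u).

(** Since the constant-component fields commute, antisymmetrizing this in [X] and [Y] gives the
    curvature, with no bracket term left. *)
Definition cov2_extend z X Y u : 'rV[R]_n :=
  N z X (cov N (extend_vec z Y) (extend_pivec z u)).

Lemma curvatureE z X Y u : D z ->
  curvature N z X Y u = cov2_extend z X Y u - cov2_extend z Y X u.
Proof.
move=> Dz; rewrite /curvature /curvature_field.
rewrite !(extend_vec_at hTM) (bracket_extend_vec hTM).
by rewrite (connection0 Dz (smooth_extend_pivec_at z u)) subr0.
Qed.

Lemma curvature_alt z X Y u : D z -> curvature N z Y X u = - curvature N z X Y u.
Proof. by move=> Dz; rewrite (curvatureE X Y u Dz) (curvatureE Y X u Dz) opprB. Qed.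

(** Metricity along Y near z writes the inner derivative as [g1 + g2]; metricity along X at z then
    differentiates each summand. [connection_smooth] makes the covariant derivatives inside [g1] and
    [g2] admissible for this second use. *)
Lemma derive2_metric z X Y u v : D z ->
  'D_X ('D_Y ((fun w => finsler_metric F w (extend_pivec z u w)
    (extend_pivec z v w)) \o @psi _ _ TM (chart_at z))) (@phi _ _ TM (chart_at z) z) =
  finsler_metric F z (cov2_extend z X Y u) v +
  finsler_metric F z (cov_extend z Y u) (cov_extend z X v) +
  (finsler_metric F z (cov_extend z X u) (cov_extend z Y v) +
   finsler_metric F z u (cov2_extend z X Y v)).
Proof.
pose U := extend_pivec z u; pose V := extend_pivec z v.
move=> Dz; have zz := charts_atP hM z.1.
have sU : smooth_pivfield_at U z by exact: smooth_extend_pivec_at.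
have sV : smooth_pivfield_at V z by exact: smooth_extend_pivec_at.
have sY := extend_vec_smooth hTM z Y.
have sNU := connection_smooth lN Dz sY sU.
have sNV := connection_smooth lN Dz sY sV.
have Yz : extend_vec z Y z = Y by exact: (extend_vec_at hTM).
pose g1 (w : TM) := finsler_metric F w (cov N (extend_vec z Y) U w) (V w).
pose g2 (w : TM) := finsler_metric F w (U w) (cov N (extend_vec z Y) V w).
have s1 : smooth_fun_at g1 z by exact: (smooth_metric hM hF Dz sNU sV).
have s2 : smooth_fun_at g2 z by exact: (smooth_metric hM hF Dz sU sNV).
have E1 : vec_deriv z X g1 = finsler_metric F z (cov2_extend z X Y u) v +
    finsler_metric F z (cov_extend z Y u) (cov_extend z X v).
  have := cartan_metrical hN X Dz sNU sV.
  by rewrite /cov Yz [V z](extend_pivec_at hM).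
have E2 : vec_deriv z X g2 = finsler_metric F z (cov_extend z X u) (cov_extend z Y v) +
    finsler_metric F z u (cov2_extend z X Y v).
  have := cartan_metrical hN X Dz sU sNV.
  by rewrite /cov Yz [U z](extend_pivec_at hM).
rewrite -E1 -E2.
have d1 := diff_derivable (v := X) (smooth_at_differentiable s1).
have d2 := diff_derivable (v := X) (smooth_at_differentiable s2).
apply: etrans
  (esym (vec_deriv_extend_vec2 hTM X Y (smooth_metric_extend hM hF u v Dz))) _.
apply: etrans _ (deriveD d1 d2).
(* The outer derivative sees a whole neighbourhood of [z]; [D] is open and the extensions stay
   smooth there, so metricity holds at each nearby point. *)
apply: near_eq_derive; apply: filterS (near_domain hM hF Dz zz) => a [Da ca _].
by apply: (cartan_metrical hN _ Da); exact: extend_pivec_smooth.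
Qed.

(** The algebra behind skewness: [c], [d], [e], [f] stand for first covariant derivatives, whose
    products occur on both sides and cancel; the second derivatives remain. *)
Lemma metric_skew z (p q a b a' b' c d e f u v : 'rV[R]_n) : D z ->
  p = a - b -> q = a' - b' ->
  finsler_metric F z a v + finsler_metric F z c d +
    (finsler_metric F z e f + finsler_metric F z u a') =
  finsler_metric F z b v + finsler_metric F z e f +
    (finsler_metric F z c d + finsler_metric F z u b') ->
  finsler_metric F z p v = - finsler_metric F z q u.
Proof.
move=> Dz -> ->; rewrite !finsler_metricBl.
by rewrite (finsler_metricC hM hF a' u Dz) (finsler_metricC hM hF b' u Dz); lra.
Qed.

Lemma curvature_skew z X Y u v : D z ->
  finsler_metric F z (curvature N z X Y u) v =
  - finsler_metric F z (curvature N z X Y v) u.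
Proof.
move=> Dz.
have S := smooth_at_derive_sym X Y (smooth_metric_extend hM hF u v Dz).
have E := etrans (esym (derive2_metric X Y u v Dz))
  (etrans (esym S) (derive2_metric Y X u v Dz)).
exact: metric_skew Dz (curvatureE X Y u Dz) (curvatureE X Y v Dz) E.
Qed.

Lemma bar_horizontal_surj z u : D z -> exists2 X, horizontal N z X & bar z X = u.
Proof.
(* [row_mx u 0] is one vector over [u]; removing its vertical part does not change the
   projection. *)
move=> Dz; have [_ /(_ (row_mx u 0))[A [B [vA hB E]]]] := (cartan_regular hN).2 z Dz.
exists B => //; rewrite (bar_lsubmx hM).
have : lsubmx A = 0 by rewrite -(bar_lsubmx hM z).
by move=> A0; rewrite -[RHS](row_mxKl u (0 : 'rV[R]_n)) E linearD/= A0 add0r.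
Qed.

Lemma h_curvature_pair_symmetry z :
  D z ->
  (forall u v w, h_curvature N z u v w + h_curvature N z v w u +
    h_curvature N z w u v = 0) ->
  forall u v w t, finsler_metric F z (h_curvature N z u v w) t =
    finsler_metric F z (h_curvature N z w t u) v.
Proof.
move=> Dz cyc.
apply: (@pair_symmetry R _ (fun u v w t => finsler_metric F z (h_curvature N z u v w) t)).
- by move=> u v w t; rewrite /h_curvature curvature_alt// finsler_metricNl.
- by move=> u v w t; exact: curvature_skew.
- move=> u v w t; rewrite -!finsler_metricDl -/TM cyc.
  exact: finsler_metric0l.
Qed.

End Curvature.

(** * Nullity space and kernel space *)

Theorem theorem2p5 (R : realType) (n : nat) (M : atlas R n)
    (D : set (tangent_bundle M)) (F : tangent_bundle M -> R)
    (nabla : connection M)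
    (hM : smooth_manifold M)
    (hF : finsler_function D F)
    (hnabla : cartan_connection D F nabla)
    (hcyclic : forall (X Y Z : tangent_bundle M -> 'rV[R]_n)
        (z : tangent_bundle M), D z ->
      smooth_pivfield_at X z -> smooth_pivfield_at Y z ->
      smooth_pivfield_at Z z ->
      h_curvature nabla z (X z) (Y z) (Z z) +
      h_curvature nabla z (Y z) (Z z) (X z) +
      h_curvature nabla z (Z z) (X z) (Y z) = 0) :
  forall z : tangent_bundle M, D z ->
    nullity_space nabla z = kernel_space nabla z.
Proof.
move=> z Dz; have cM := manifold_smooth_charts hM.
(* Any three vectors at [z] are values of smooth fields with constant components, so the cyclic
   identity for fields becomes pointwise. *)
have cyc u v w : h_curvature nabla z u v w + h_curvature nabla z v w u +
    h_curvature nabla z w u v = 0.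
  have := hcyclic _ _ _ z Dz (smooth_extend_pivec_at cM z u)
    (smooth_extend_pivec_at cM z v) (smooth_extend_pivec_at cM z w).
  by rewrite !(extend_pivec_at cM).
have sym := h_curvature_pair_symmetry cM hF hnabla Dz cyc.
apply/seteqP; split=> [_ [X [hX X0] <-] Y Z hY hZ|u u0].
  (* Pair symmetry puts X and the test vector [t] in the first two slots; nullity applies once [t]
     is the projection of a horizontal vector. *)
  apply: (finsler_metric_nondegenerate hF Dz) => t; rewrite sym.
  have [T hT <-] := bar_horizontal_surj cM hnabla t Dz.
  by rewrite X0// finsler_metric0l.
have [X hX Xu] := bar_horizontal_surj cM hnabla u Dz.
exists X => //; split=> // Y hY w; rewrite Xu.
(* Conversely [u] moves to the third slot of R, and now both [w] and [t] need horizontal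
   representatives. *)
apply: (finsler_metric_nondegenerate hF Dz) => t; rewrite sym.
have [W hW <-] := bar_horizontal_surj cM hnabla w Dz.
have [T hT <-] := bar_horizontal_surj cM hnabla t Dz.
by rewrite u0// finsler_metric0l.
Qed.
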